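(* Let $\mathfrak{F}_1,\mathfrak{F}_1',\mathfrak{F}_2,\mathfrak{F}_2'$ be the classes of $\hat N$-frames, $\hat N'$-frames, sub-normal frames and sub-normal identity frames respectively. Let $\Phi:\mathfrak{F}_2\to\mathfrak{F}_1$ send $(W,\leq,Y_0)$ to $(W,\leq,R_{N_1},R_{N_2})$, where $xR_{N_1}y$ iff $\exists z(x\leq z\ \&\ y\leq z)$ and $xR_{N_2}y$ iff $\exists z(x\leq z\ \&\ y\leq z\ \&\ z\notin Y_0)$; and let $\Psi:\mathfrak{F}_1\to\mathfrak{F}_2$ send $(W,\leq,R_{N_1},R_{N_2})$ to $(W,\leq,Y_0)$, where $Y_0=\{z\in W:\text{there is no }x\in W\text{ with }zR_{N_2}x\}$. Then: 1. (a) $\Phi\Psi$ and $\Psi\Phi$ are the identity maps on $\mathfrak{F}_1$ and $\mathfrak{F}_2$ respectively. (b) $\Phi|_{\mathfrak{F}_2'}\Psi|_{\mathfrak{F}_1'}$ and $\Psi|_{\mathfrak{F}_1'}\Phi|_{\mathfrak{F}_2'}$ are the identity maps on $\mathfrak{F}_1'$ and $\mathfrak{F}_2'$ respectively. 2. For every formula $\alpha\in F$: (a) $\mathfrak{F}_1\vDash\alpha\Leftrightarrow\mathfrak{F}_2\vDash\alpha$, and (b) $\mathfrak{F}_1'\vDash\alpha\Leftrightarrow\mathfrak{F}_2'\vDash\alpha$.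
   Context: $F$ is the set of formulas built from propositional variables and constants $\top,\bot$ with $\wedge,\vee,\rightarrow,\neg,\sim$. A sub-normal frame is $(W,\leq,Y_0)$ with $(W,\leq)$ a nonempty poset and $Y_0\subseteq W$ an upset such that for all $x\in W$: if for every $y\geq x$ there is $z\geq y$ with $z\in Y_0$, then $x\in Y_0$. It is a sub-normal identity frame if moreover for all $x,y\in W\setminus Y_0$, $x\leq y$ implies $y\leq x$. A strictly condensed $J$-frame is a triple $(X,\leq,R_N)$ with $(X,\leq)$ a nonempty poset and $R_N$ a binary relation on $X$ such that: (i) $x\leq x'$, $x'R_Ny'$, $y\leq y'$ imply $xR_Ny$; (ii) $R_N$ is symmetric; (iii) $\forall x,y\,(xR_Ny\Rightarrow\exists z(x\leq z\ \&\ y\leq z\ \&\ xR_Nz))$. It is a strictly condensed $H$-frame if moreover $R_N$ is reflexive. An $\hat N$-frame is $(X,\leq,R_{N_1},R_{N_2})$ such that (1) $(X,\leq,R_{N_1})$ is a strictly condensed $H$-frame; (2) $(X,\leq,R_{N_2})$ is a strictly condensed $J$-frame; (3) for all $x\in X$: if for every $y$ with $xR_{N_1}y$ there is $z$ with $yR_{N_1}z$ and no $z'$ with $zR_{N_2}z'$, then there is no $z''$ with $xR_{N_2}z''$. An $\hat N'$-frame is an $\hat N$-frame such that $xR_{N_2}y$ implies $y\leq x$. ($\Phi$ and $\Psi$ are well defined between the indicated classes, and restrict to maps between $\mathfrak{F}_2'$ and $\mathfrak{F}_1'$.) On either kind of frame, a valuation assigns an upset to each propositional variable. Truth: variables via $v$;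 $\top$ everywhere, $\bot$ nowhere; $\wedge,\vee$ pointwise; $x\vDash\alpha\rightarrow\beta$ iff for all $y\geq x$, $y\vDash\alpha$ implies $y\vDash\beta$. On sub-normal frames: $x\vDash\neg\alpha$ iff for all $y\geq x$, $y\nvDash\alpha$; $x\vDash\sim\alpha$ iff for all $y\geq x$, $y\vDash\alpha$ implies $y\in Y_0$. On $\hat N$-frames: $x\vDash\neg\alpha$ iff for all $y$, $xR_{N_1}y$ implies $y\nvDash\alpha$; $x\vDash\sim\alpha$ iff for all $y$, $xR_{N_2}y$ implies $y\nvDash\alpha$. For a class $\mathfrak{F}$ of frames, $\mathfrak{F}\vDash\alpha$ means $\alpha$ is true at every point under every valuation on every frame in $\mathfrak{F}$. *)

(* Defs.v *)
From Stdlib Require Import Relation_Definitions Classical.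

Inductive form : Type :=
| Var (p : nat)
| Top
| Bot
| And (a b : form)
| Or (a b : form)
| Imp (a b : form)
| Neg (a : form)   (* ¬ *)
| Tilde (a : form) (* ∼ *).

Definition nonempty_poset (W : Type) (le : relation W) : Prop :=
  inhabited W /\ order W le.

Definition upset (W : Type) (le : relation W) (U : W -> Prop) : Prop :=
  forall x y, le x y -> U x -> U y.

Record is_subnormal (W : Type) (le : relation W) (Y0 : W -> Prop) : Prop := {
  sn_poset : nonempty_poset W le;
  sn_upset : upset W le Y0;
  sn_dense : forall x,
    (forall y, le x y -> exists z, le y z /\ Y0 z) -> Y0 x
}.

Record subnormal_frame : Type := SubnormalFrame {
  sn_carrier :> Type;
  sn_le : relation sn_carrier;
  sn_Y0 : sn_carrier -> Prop;
  sn_axioms : is_subnormal sn_carrier sn_le sn_Y0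
}.

Definition is_identity_frame (F : subnormal_frame) : Prop :=
  forall x y : F, ~ sn_Y0 F x -> ~ sn_Y0 F y -> sn_le F x y -> sn_le F y x.

Record is_condensed_J (X : Type) (le R : relation X) : Prop := {
  cJ_poset : nonempty_poset X le;
  cJ_mono : forall x x' y y', le x x' -> R x' y' -> le y y' -> R x y;
  cJ_sym : symmetric X R;
  cJ_condensed : forall x y, R x y -> exists z, le x z /\ le y z /\ R x z
}.

Record is_condensed_H (X : Type) (le R : relation X) : Prop := {
  cH_J : is_condensed_J X le R;
  cH_refl : reflexive X R
}.

Record is_Nhat (X : Type) (le R1 R2 : relation X) : Prop := {
  N_H : is_condensed_H X le R1;
  N_J : is_condensed_J X le R2;
  N_compat : forall x,
    (forall y, R1 x y -> exists z, R1 y z /\ ~ exists z', R2 z z') ->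
    ~ exists z'', R2 x z''
}.

Record Nhat_frame : Type := NhatFrame {
  N_carrier :> Type;
  N_le : relation N_carrier;
  N_R1 : relation N_carrier;
  N_R2 : relation N_carrier;
  N_axioms : is_Nhat N_carrier N_le N_R1 N_R2
}.

Definition is_Nhat_prime (F : Nhat_frame) : Prop :=
  forall x y : F, N_R2 F x y -> N_le F y x.

Fixpoint sn_truth (F : subnormal_frame) (v : nat -> F -> Prop) (x : F)
    (a : form) : Prop :=
  match a with
  | Var p => v p x
  | Top => True
  | Bot => False
  | And b c => sn_truth F v x b /\ sn_truth F v x c
  | Or b c => sn_truth F v x b \/ sn_truth F v x c
  | Imp b c => forall y, sn_le F x y -> sn_truth F v y b -> sn_truth F v y c
  | Neg b => forall y, sn_le F x y -> ~ sn_truth F v y b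
  | Tilde b => forall y, sn_le F x y -> sn_truth F v y b -> sn_Y0 F y
  end.

Fixpoint N_truth (F : Nhat_frame) (v : nat -> F -> Prop) (x : F)
    (a : form) : Prop :=
  match a with
  | Var p => v p x
  | Top => True
  | Bot => False
  | And b c => N_truth F v x b /\ N_truth F v x c
  | Or b c => N_truth F v x b \/ N_truth F v x c
  | Imp b c => forall y, N_le F x y -> N_truth F v y b -> N_truth F v y c
  | Neg b => forall y, N_R1 F x y -> ~ N_truth F v y b
  | Tilde b => forall y, N_R2 F x y -> ~ N_truth F v y b
  end.

Definition sn_valid (K : subnormal_frame -> Prop) (a : form) : Prop :=
  forall F : subnormal_frame, K F ->
  forall v : nat -> F -> Prop, (forall p, upset F (sn_le F) (v p)) ->
  forall x : F, sn_truth F v x a.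

Definition N_valid (K : Nhat_frame -> Prop) (a : form) : Prop :=
  forall F : Nhat_frame, K F ->
  forall v : nat -> F -> Prop, (forall p, upset F (N_le F) (v p)) ->
  forall x : F, N_truth F v x a.

Definition Phi_R1 (W : Type) (le : relation W) : relation W :=
  fun x y => exists z, le x z /\ le y z.

Definition Phi_R2 (W : Type) (le : relation W) (Y0 : W -> Prop) : relation W :=
  fun x y => exists z, le x z /\ le y z /\ ~ Y0 z.

Definition Psi_Y0 (W : Type) (R2 : relation W) : W -> Prop :=
  fun z => ~ exists x, R2 z x.

Lemma Phi_is_Nhat (W : Type) (le : relation W) (Y0 : W -> Prop) :
  is_subnormal W le Y0 -> is_Nhat W le (Phi_R1 W le) (Phi_R2 W le Y0).
Proof.
intros [Hp Hup Hd].
pose proof Hp as [_ [Hr Ht _]].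
split; [split; [split |] | split |].
- exact Hp.
- intros x x' y y' Hx [z [H1 H2]] Hy; exists z; split; eauto.
- intros x y [z [H1 H2]]; exists z; auto.
- intros x y [z [H1 H2]]; exists z; repeat split; auto; exists z; auto.
- intros x; exists x; auto.
- exact Hp.
- intros x x' y y' Hx [z [H1 [H2 H3]]] Hy; exists z; repeat split; eauto.
- intros x y [z [H1 [H2 H3]]]; exists z; auto.
- intros x y [z [H1 [H2 H3]]]; exists z; repeat split; auto; exists z; auto.
- intros x H [y [z [Hxz [_ Hz]]]]; apply Hz.
  apply (Hup x z Hxz), Hd; intros u Hxu.
  destruct (H u) as [w [[t [Hut Hwt]] Hw]]; [exists u; auto |].
  exists t; split; [exact Hut |].
  apply NNPP; intros Hn; apply Hw; exists t, t; auto.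
Qed.

Lemma Psi_is_subnormal (W : Type) (le R1 R2 : relation W) :
  is_Nhat W le R1 R2 -> is_subnormal W le (Psi_Y0 W R2).
Proof.
intros [[[Hp Hm1 Hs1 Hc1] Hr1] [_ Hm2 Hs2 Hc2] Hcompat].
pose proof Hp as [_ [Hr Ht _]].
split.
- exact Hp.
- intros x y Hxy Hx [z Hz]; apply Hx; exists z; eauto.
- intros x H; apply Hcompat; intros y Hxy.
  destruct (Hc1 x y Hxy) as [u [Hxu [Hyu _]]].
  destruct (H u Hxu) as [z [Huz Hz]].
  exists z; split; [| exact Hz].
  exact (Hm1 y z z z (Ht _ _ _ Hyu Huz) (Hr1 z) (Hr z)).
Qed.

Definition Phi (F : subnormal_frame) : Nhat_frame :=
  NhatFrame F (sn_le F) (Phi_R1 F (sn_le F)) (Phi_R2 F (sn_le F) (sn_Y0 F))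
    (Phi_is_Nhat F (sn_le F) (sn_Y0 F) (sn_axioms F)).

Definition Psi (F : Nhat_frame) : subnormal_frame :=
  SubnormalFrame F (N_le F) (Psi_Y0 F (N_R2 F))
    (Psi_is_subnormal F (N_le F) (N_R1 F) (N_R2 F) (N_axioms F)).

Lemma Phi_prime (F : subnormal_frame) :
  is_identity_frame F -> is_Nhat_prime (Phi F).
Proof.
destruct (sn_axioms F) as [[_ [Hr Ht _]] Hup _].
intros H x y [z [Hxz [Hyz Hz]]]; simpl in *.
apply (Ht _ z); [exact Hyz |].
apply H; auto; simpl; intros Hx; exact (Hz (Hup _ _ Hxz Hx)).
Qed.

Lemma Psi_prime (F : Nhat_frame) :
  is_Nhat_prime F -> is_identity_frame (Psi F).
Proof.
destruct (N_axioms F) as [_ [_ Hm _ Hc] _].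
intros H x y _ Hy Hxy; apply NNPP in Hy; simpl in *.
destruct Hy as [w Hw]; destruct (Hc _ _ Hw) as [u [Hyu [_ Hu]]].
apply H; simpl; exact (Hm _ _ _ _ Hxy Hu Hyu).
Qed.

Definition Phi_restr (F : {F : subnormal_frame | is_identity_frame F}) :
    {F : Nhat_frame | is_Nhat_prime F} :=
  exist _ (Phi (proj1_sig F)) (Phi_prime (proj1_sig F) (proj2_sig F)).

Definition Psi_restr (F : {F : Nhat_frame | is_Nhat_prime F}) :
    {F : subnormal_frame | is_identity_frame F} :=
  exist _ (Psi (proj1_sig F)) (Psi_prime (proj1_sig F) (proj2_sig F)).

(* Main.v *)
Require Import Defs.
From Stdlib Require Import Relation_Definitions Classical.
From Stdlib Require Import FunctionalExtensionality PropExtensionality.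

(** Condensation makes both relations of an N^-frame recoverable from the order
    and [Y0]: related points have a common upper bound that is still related to
    them, and conversely, by reflexivity of [R_N1] (resp. because a point outside
    [Y0] is [R_N2]-related to some point above it), relatedness transfers down
    from a common upper bound.  So [Phi] and [Psi] are mutually inverse, and since
    truth sets are upsets, looking for witnesses among common upper bounds does
    not change the meaning of the two negations. *)

Lemma relation_ext (W : Type) (R S : relation W) :
  (forall x y, R x y <-> S x y) -> R = S.
Proof.
intros H; extensionality x; extensionality y.
apply propositional_extensionality, H.
Qed.

Lemma Phi_R1_condensed (W : Type) (le R : relation W) :
  is_condensed_H W le R -> Phi_R1 W le = R.
Proof.
intros [[_ Hm _ Hc] Hr]; apply relation_ext; intros x y; split.
- intros [z [Hx Hy]]; exact (Hm _ _ _ _ Hx (Hr z) Hy).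
- intros H; destruct (Hc _ _ H) as [z [Hx [Hy _]]]; exists z; auto.
Qed.

Lemma Phi_R2_Psi_Y0 (W : Type) (le R : relation W) :
  is_condensed_J W le R -> Phi_R2 W le (Psi_Y0 W R) = R.
Proof.
intros [[_ [_ Ht _]] Hm Hs Hc]; apply relation_ext; intros x y; split.
- intros [z [Hx [Hy Hz]]]; apply NNPP in Hz; destruct Hz as [w Hw].
  destruct (Hc _ _ Hw) as [u [Hzu [_ Hu]]].
  exact (Hm _ _ _ _ Hx Hu (Ht _ _ _ Hy Hzu)).
- intros H; destruct (Hc _ _ H) as [z [Hx [Hy Hz]]].
  exists z; repeat split; auto.
  (* By symmetry [R x z] gives [R z x], which puts [z] outside [Psi_Y0]. *)
  intros Hn; apply Hn; exists x; auto.
Qed.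

Lemma Psi_Y0_Phi_R2 (W : Type) (le : relation W) (Y0 : W -> Prop) :
  is_subnormal W le Y0 -> Psi_Y0 W (Phi_R2 W le Y0) = Y0.
Proof.
intros [[_ [Hr _ _]] Hup _]; extensionality z.
apply propositional_extensionality; split.
(* A point outside [Y0] serves as its own upper bound, so it is related to itself. *)
- intros H; apply NNPP; intros Hz; apply H; exists z, z; auto.
- intros Hz [x [t [Hzt [_ Ht]]]]; exact (Ht (Hup _ _ Hzt Hz)).
Qed.

(** Frames carry a proof of their axioms; proof irrelevance leaves only the relations to compare. *)
Lemma NhatFrame_eq (W : Type) (le R1 R1' R2 R2' : relation W)
    (H : is_Nhat W le R1 R2) (H' : is_Nhat W le R1' R2') :
  R1 = R1' -> R2 = R2' -> NhatFrame W le R1 R2 H = NhatFrame W le R1' R2' H'.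
Proof. intros -> ->; f_equal; apply proof_irrelevance. Qed.

Lemma SubnormalFrame_eq (W : Type) (le : relation W) (Y Y' : W -> Prop)
    (H : is_subnormal W le Y) (H' : is_subnormal W le Y') :
  Y = Y' -> SubnormalFrame W le Y H = SubnormalFrame W le Y' H'.
Proof. intros ->; f_equal; apply proof_irrelevance. Qed.

Lemma Phi_Psi (F : Nhat_frame) : Phi (Psi F) = F.
Proof.
destruct F as [W le R1 R2 HF]; apply NhatFrame_eq.
- exact (Phi_R1_condensed W le R1 (N_H _ _ _ _ HF)).
- exact (Phi_R2_Psi_Y0 W le R2 (N_J _ _ _ _ HF)).
Qed.

Lemma Psi_Phi (F : subnormal_frame) : Psi (Phi F) = F.
Proof.
destruct F as [W le Y0 HF]; apply SubnormalFrame_eq.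
exact (Psi_Y0_Phi_R2 W le Y0 HF).
Qed.

(** Persistence, needed to carry truth from a related point up to a common upper bound. *)
Lemma sn_truth_upset (F : subnormal_frame) (v : nat -> F -> Prop) (a : form) :
  (forall p, upset F (sn_le F) (v p)) ->
  upset F (sn_le F) (fun x => sn_truth F v x a).
Proof.
intros Hv; destruct (sn_axioms F) as [[_ [_ Ht _]] _ _].
induction a; intros x y Hxy; simpl; eauto.
- exact (Hv p x y Hxy).
- intros [H1 H2]; split; eauto.
- intros [H | H]; eauto.
Qed.

Lemma N_truth_Phi (F : subnormal_frame) (v : nat -> F -> Prop) (a : form) :
  (forall p, upset F (sn_le F) (v p)) ->
  forall x : F, N_truth (Phi F) v x a <-> sn_truth F v x a.
Proof.
intros Hv; destruct (sn_axioms F) as [[_ [Hr _ _]] _ _].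
induction a as [p | | | b IHb c IHc | b IHb c IHc | b IHb c IHc | b IHb | b IHb];
  intros x; simpl; try tauto.
- rewrite IHb, IHc; tauto.
- rewrite IHb, IHc; tauto.
- split; intros H y Hxy Hy; apply IHc, H, IHb; auto.
- split.
  + intros H y Hxy Hy; apply (H y); [exists y; auto | apply IHb, Hy].
  + intros H y [z [Hxz Hyz]] Hy; apply (H z Hxz).
    apply (sn_truth_upset F v b Hv y z Hyz), IHb, Hy.
- split.
  (* If [y] were outside [Y0], then [y] itself would witness that [x] and [y] are related by
     [Phi_R2]. *)
  + intros H y Hxy Hy; apply NNPP; intros Hn.
    apply (H y); [exists y; auto | apply IHb, Hy].
  + intros H y [z [Hxz [Hyz Hz]]] Hy; apply Hz, (H z Hxz).
    apply (sn_truth_upset F v b Hv y z Hyz), IHb, Hy.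
Qed.

Lemma valid_iff (K : Nhat_frame -> Prop) (L : subnormal_frame -> Prop)
    (a : form) :
  (forall F, L F -> K (Phi F)) -> (forall F, K F -> L (Psi F)) ->
  (N_valid K a <-> sn_valid L a).
Proof.
intros HPhi HPsi; split; intros H F HF.
- intros v Hv x; apply (N_truth_Phi F v a Hv), (H (Phi F) (HPhi F HF) v Hv).
(* Every N^-frame is an image under [Phi]; rewriting precedes the introduction of [v] and [x], whose
   types depend on the frame. *)
- rewrite <- (Phi_Psi F); intros v Hv x.
  apply (N_truth_Phi (Psi F) v a Hv), (H (Psi F) (HPsi F HF) v Hv).
Qed.

Theorem theorem5p7 :
  ((forall F : Nhat_frame, Phi (Psi F) = F) /\
   (forall F : subnormal_frame, Psi (Phi F) = F)) /\
  ((forall F : {F : Nhat_frame | is_Nhat_prime F},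
      Phi_restr (Psi_restr F) = F) /\
   (forall F : {F : subnormal_frame | is_identity_frame F},
      Psi_restr (Phi_restr F) = F)) /\
  (forall a : form,
     (N_valid (fun _ => True) a <-> sn_valid (fun _ => True) a) /\
     (N_valid is_Nhat_prime a <-> sn_valid is_identity_frame a)).
Proof.
split; [split; [exact Phi_Psi | exact Psi_Phi] |].
split; [split |].
(* Membership in the subclass is a proposition, so equality of the underlying frames suffices. *)
- intros F; apply eq_sig_hprop; [intros; apply proof_irrelevance | apply Phi_Psi].
- intros F; apply eq_sig_hprop; [intros; apply proof_irrelevance | apply Psi_Phi].
- intros a; split; apply valid_iff; auto using Phi_prime, Psi_prime.
Qed.
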